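(* (1) For every countable set $A\subset\mathbb{R}^2$, there exists a Baire 2 function $f\colon\mathbb{R}^2\to\mathbb{R}$ such that $A\subset VFC(f)\setminus FC(f)$. (2) There is a Baire 1 function $f\colon\mathbb{R}^2\to\mathbb{R}$ for which the set $VFC(f)\setminus FC(f)$ is (nonempty) perfect. (3) There exists a Baire 2 function $f\colon\mathbb{R}^2\to\mathbb{R}$ for which the set $VFC(f)\setminus FC(f)$ is $\mathfrak{c}$-dense in $\mathbb{R}^2$, that is, its intersection with every nonempty open subset of $\mathbb{R}^2$ has cardinality $\mathfrak{c}$.
   Context: Notation: $x_n\searrow x$ means that $(x_n)$ is a strictly decreasing sequence of reals converging to $x$; $\mathfrak{c}$ is the cardinality of the continuum. Let $f\colon\mathbb{R}^2\to\mathbb{R}$. $f$ is feebly continuous at $\langle x,y\rangle$ if there exist sequences $x_n\searrow x$ and $y_m\searrow y$ such that $\lim_{n\to\infty}\lim_{m\to\infty}f(x_n,y_m)=f(x,y)$. $f$ is very feebly continuous at $\langle x,y\rangle$ if there exist a sequence $x_n\searrow x$ and, for each $n\in\mathbb{N}$, a sequence $y^{(n)}_m\searrow y$ (as $m\to\infty$) such that $\lim_{n\to\infty}\lim_{m\to\infty}f(x_n,y^{(n)}_m)=f(x,y)$. (In both cases the inner limits exist in $\mathbb{R}$ for each $n$, and the outer limit exists.) $FC(f)$ and $VFC(f)$ denote the sets of all points of $\mathbb{R}^2$ at which $f$ is feebly continuous, respectively very feebly continuous. Baire 1 functions are pointwise limits of sequences of continuous functions; Baire 2 functions are pointwise limits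 of sequences of Baire 1 functions. *)

(* Defs.v *)
From mathcomp Require Import all_boot all_order all_algebra.
From mathcomp Require Import all_classical all_reals all_analysis.

Set Implicit Arguments.
Unset Strict Implicit.
Unset Printing Implicit Defensive.

Import Order.TTheory GRing.Theory Num.Theory.
Import numFieldNormedType.Exports.

Local Open Scope classical_set_scope.
Local Open Scope ring_scope.

(* [decreasing_seq] is strict: it unfolds to [(u m <= u n) = (n <= m)]. *)
Definition decreases_to (R : realType) (u : R^nat) (x : R) : Prop :=
  decreasing_seq u /\ u @ \oo --> x.

(* In the next two definitions [g n] is the value of the inner limit at [n], so
   that existence (in [R]) of every inner limit is part of the requirement. *)
Definition feebly_continuous_at (R : realType) (f : R * R -> R) (p : R * R) :
    Prop :=
  exists x y g : R^nat,
    [/\ decreases_to x p.1,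
        decreases_to y p.2,
        forall n, f (x n, y m) @[m --> \oo] --> g n
      & g @ \oo --> f p].

Definition very_feebly_continuous_at (R : realType) (f : R * R -> R)
    (p : R * R) : Prop :=
  exists (x : R^nat) (y : nat -> R^nat) (g : R^nat),
    [/\ decreases_to x p.1,
        forall n, decreases_to (y n) p.2,
        forall n, f (x n, y n m) @[m --> \oo] --> g n
      & g @ \oo --> f p].

Definition FC (R : realType) (f : R * R -> R) : set (R * R) :=
  [set p | feebly_continuous_at f p].

Definition VFC (R : realType) (f : R * R -> R) : set (R * R) :=
  [set p | very_feebly_continuous_at f p].

Definition Baire1 (R : realType) (T : topologicalType) (f : T -> R) : Prop :=
  exists h : nat -> T -> R,
    (forall n, continuous (h n)) /\ (forall t, h n t @[n --> \oo] --> f t).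

Definition Baire2 (R : realType) (T : topologicalType) (f : T -> R) : Prop :=
  exists h : nat -> T -> R,
    (forall n, Baire1 (h n)) /\ (forall t, h n t @[n --> \oo] --> f t).

Definition continuum_dense (R : realType) (T : topologicalType) (S : set T) :
    Prop :=
  forall U : set T, open U -> U !=set0 -> ((S `&` U) #= [set: R])%card.

(* Main.v *)
Require Import Defs.
From mathcomp Require Import all_boot all_order all_algebra.
From mathcomp Require Import all_classical all_reals all_analysis.
From mathcomp Require Import lra.

Set Implicit Arguments.
Unset Strict Implicit.
Unset Printing Implicit Defensive.

Import Order.TTheory GRing.Theory Num.Theory.
Import numFieldNormedType.Exports.

Local Open Scope classical_set_scope.
Local Open Scope ring_scope.

(** The theorem rests on one continuous function of two real variables,
      k(x, y) = (y - q) ((x - s) cos (1 / (y - q)) - sin (1 / (y - q))),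
    whose zero set K consists of the line y = q and of the curve
    x = s + tan (1 / (y - q)).  Two features of K matter.
    - Near the line, the curve crosses every vertical line infinitely often:
      for each x there are y_m decreasing to q with (x, y_m) on the curve
      ([tan_curve_zeros]).
    - Off the line, every horizontal line meets K at most once
      ([tan_curve_inj]).
    For the indicator function of K, the first feature makes every point of the
    line y = q a point of very feeble continuity.  The second one forbids feeble
    continuity: a single sequence y_m serving two abscissae would put two
    points of K at the same height y_m <> q.

    To handle countably many lines y = q_j, with closed sets K_j, let f take the
    value 1 / (j + 1) where j is the least index with the point in K_j, and 0
    outside all the K_j ([tan_layers]).  It is a pointwise limit of functions
    with finitely many layers, each of Baire class 1, so f is of Baire class 2.
    - No point with f > 0 is a point of feeble continuity
      ([tan_layers_not_FC]).  Were (x_n), (y_m) witnesses at a point of value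
      1 / (i + 1), then for all large n and then all large m the value
      f(x_n, y_m) would exceed 1 / (i + 2), so (x_n, y_m) would lie in one of
      K_0, ..., K_i.  Among i + 2 values of n two would share the same K_j, for
      a y_m different from q_j.
    - A point (x, q_i) outside K_0, ..., K_{i-1} is one of very feeble
      continuity ([tan_layers_VFC]): near it the smaller layers are absent,
      so f = 1 / (i + 1) at all points of K_i nearby.

    For (1), the q_j are the ordinates of the points of A, and each s_j is chosen
    outside a countable set so that the j-th curve misses A.  For (2), all layers
    are equal; f is then the indicator function of a single K, of Baire class 1,
    and VFC f minus FC f is exactly the line.  For (3), the q_j enumerate the
    rationals; on each rational line, only finitely many points lie in the
    layers preceding it, so every open set contains a whole horizontal segment of
    VFC f minus FC f.  The upper bound on the cardinality is that of R * R, which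
    injects into R through Dedekind cuts and ternary expansions. *)

(** * Strictly decreasing sequences *)

Lemma decreases_to_in_nbhs (R : realType) (x : R) (V : set R) :
  nbhs x V -> exists u, decreases_to u x /\ forall n, V (u n).
Proof.
move=> /nbhs_ballP[e /= e0 eV].
exists (fun n => x + e * n.+2%:R^-1); split; first split.
- move=> m n; rewrite lerD2l ler_pM2l // lef_pV2 ?posrE ?ltr0n //.
  by rewrite ler_nat.
- rewrite -[X in _ --> X]addr0 -[X in _ + X](mulr0 e).
  apply: cvgD; first exact: cvg_cst.
  apply: cvgM; first exact: cvg_cst.
  by have := @cvg_harmonic R; rewrite -(cvg_shiftS (@harmonic R)).
- move=> n; apply: eV; rewrite /ball /= opprD addNKr normrN.
  rewrite gtr0_norm ?mulr_gt0 ?invr_gt0 ?ltr0n //.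
  by rewrite gtr_pMr // invf_lt1 ?ltr0n // ltr1n.
Qed.

Lemma decreases_to_neq (R : realType) (u : R^nat) (x z : R) :
  decreases_to u x -> \forall m \near \oo, u m != z.
Proof.
move=> [du _].
have du' m n : (m < n)%N -> u n < u m by move=> mn; rewrite ltNge du -ltnNge.
have [[m0 um0]|nz] := pselect (exists m, u m = z).
  by exists m0.+1 => // m /= m0m; rewrite -um0 lt_eqF// du'.
by near=> m; apply/eqP => umz; apply: nz; exists m.
Unshelve. all: by end_near. Qed.

Lemma decreases_to_gt (R : realType) (u : R^nat) (x : R) (n : nat) :
  decreases_to u x -> x < u n.
Proof.
move=> [du ux]; apply: (@le_lt_trans _ _ (u n.+1)).
  have : u m @[m --> \oo] --> x by [].
  move/cvg_lim => <- //; apply: limr_le.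
    by apply/cvg_ex; exists x.
  by exists n.+1 => // m /= nm; rewrite du.
by rewrite ltNge du -ltnNge.
Qed.

(** * The line y = q together with a tangent curve accumulating on it *)

(** At 0 the factor [u] damps the oscillation of [g u^-1]; elsewhere this is a
    composition of continuous functions. *)
Lemma mul_comp_inv_continuous (R : realType) (g : R -> R) :
  continuous g -> (forall z, `|g z| <= 1) -> continuous (fun u : R => u * g u^-1).
Proof.
move=> gc g1 u; have [->|u0] := eqVneq u 0; last first.
  apply: cvgM; first exact: cvg_id.
  apply: (continuous_comp (f := fun z : R => z^-1)); last exact: gc.
  exact: inv_continuous.
rewrite /continuous_at mul0r; apply: norm_cvg0.
apply: (@squeeze_cvgr _ _ _ _ (fun=> 0) (fun u : R => `|u|)).
- near=> v; rewrite normr_ge0 /= normrM ler_piMr //.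
- exact: cvg_cst.
- by rewrite -[X in _ --> X](@normr0 _ R); apply: cvg_norm; apply: cvg_id.
Unshelve. all: by end_near. Qed.

(** For p = (x, y), this vanishes iff y = q or x = s + tan (1 / (y - q)).  The
    equation of the curve is multiplied by cos (1 / (y - q)), which removes the
    poles of tan, and by y - q, which gives continuity across the line. *)
Definition tan_curve (R : realType) (q s : R) (p : R * R) : R :=
  (p.2 - q) * ((p.1 - s) * cos (p.2 - q)^-1 - sin (p.2 - q)^-1).

Lemma tan_curve_continuous (R : realType) (q s : R) :
  continuous (tan_curve q s).
Proof.
have -> : tan_curve q s = fun p : R * R =>
    (p.1 - s) * ((p.2 - q) * cos (p.2 - q)^-1) - (p.2 - q) * sin (p.2 - q)^-1.
  by apply/funext => p; rewrite /tan_curve mulrBr mulrCA.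
have sub2 (p : R * R) : p'.2 - q @[p' --> p] --> p.2 - q.
  by apply: cvgB; [exact: cvg_snd|exact: cvg_cst].
have C : forall z : R, `|cos z| <= 1.
  by move=> z; rewrite ler_norml cos_geN1 cos_le1.
have S : forall z : R, `|sin z| <= 1.
  by move=> z; rewrite ler_norml sin_geN1 sin_le1.
have dC := mul_comp_inv_continuous (@continuous_cos R) C.
have dS := mul_comp_inv_continuous (@continuous_sin R) S.
move=> p; apply: cvgB; [apply: cvgM|].
- by apply: cvgB; [exact: cvg_fst|exact: cvg_cst].
- exact: (continuous_comp (sub2 p) (dC (p.2 - q))).
- exact: (continuous_comp (sub2 p) (dS (p.2 - q))).
Qed.

Lemma tan_curve_line (R : realType) (q s x : R) : tan_curve q s (x, q) = 0.
Proof. by rewrite /tan_curve /= subrr mul0r. Qed.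

(** The cosine cannot vanish at a zero off the line, since the sine would then
    vanish at the same angle. *)
Lemma tan_curve_zero (R : realType) (q s x y : R) : y != q ->
  tan_curve q s (x, y) = 0 -> x - s = tan (y - q)^-1.
Proof.
rewrite /tan_curve /= -subr_eq0 => yq /eqP.
rewrite mulf_eq0 (negbTE yq) /= subr_eq0 => /eqP k0.
have [c0|c0] := eqVneq (cos (y - q)^-1) 0; last by rewrite /tan -k0 mulfK.
have := cos2Dsin2 (y - q)^-1; rewrite -k0 c0 mulr0 expr0n /= addr0.
by move/eqP; rewrite eq_sym oner_eq0.
Qed.

Lemma tan_curve_inj (R : realType) (q s x x' y : R) : y != q ->
  tan_curve q s (x, y) = 0 -> tan_curve q s (x', y) = 0 -> x = x'.
Proof.
move=> yq /(tan_curve_zero yq) xE /(tan_curve_zero yq) x'E.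
by apply: (addIr (- s)); rewrite xE x'E.
Qed.

(** The equation tan w = x - s has the solutions w = atan (x - s) + m pi for all
    m >= 1, which are positive and tend to infinity; take y_m = q + 1 / w. *)
Lemma tan_curve_zeros (R : realType) (q s x : R) :
  exists2 y, decreases_to y q & forall m, tan_curve q s (x, y m) = 0.
Proof.
pose w m := atan (x - s) + m.+1%:R * pi : R.
have w0 m : 0 < w m.
  have := atan_gtNpi2 (x - s); have := @pi_gt0 R => pi0 at0.
  have : 1 * pi <= m.+1%:R * pi :> R by rewrite ler_wpM2r ?ler1n // ltW.
  rewrite /w; lra.
exists (fun m => q + (w m)^-1); first split.
- move=> m n; rewrite lerD2l lef_pV2 ?posrE // /w lerD2l ler_pM2r ?pi_gt0 //.
  by rewrite ler_nat.
- rewrite -[X in _ --> X]addr0; apply: cvgD; first exact: cvg_cst.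
  apply/gtr0_cvgV0; first by near=> m; exact: w0.
  apply/cvgryPge => A; near=> m.
  rewrite /w -lerBlDl -ler_pdivrMr ?pi_gt0 //.
  near: m; exists (Num.truncn ((A - atan (x - s)) / pi)) => // m /= hm.
  apply/ltW/(lt_le_trans (truncnS_gt _)); by rewrite ler_nat ltnS.
- move=> m; rewrite /tan_curve /= addrC addKr invrK.
  suff -> : sin (w m) = (x - s) * cos (w m) by rewrite subrr mulr0.
  rewrite /w; elim: m.+1 => [|k IH].
    rewrite mul0r addr0 -[X in _ = X * _](atanK (x - s)) /tan divfK //.
    by rewrite gt_eqF// cos_gt0_pihalf // atan_gtNpi2 atan_ltpi2.
  by rewrite -natr1 mulrDl mul1r addrA sinDpi cosDpi IH mulrN.
Unshelve. all: by end_near. Qed.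

(** * Baire classes *)

Lemma Baire1_cst (R : realType) (T : topologicalType) (c : R) :
  Baire1 (fun _ : T => c).
Proof.
by exists (fun _ _ => c); split=> [n t|t]; exact: cvg_cst.
Qed.

(** The weights b_n = 1 / (1 + n |k|) are continuous, equal to 1 where k = 0 and
    tending to 0 elsewhere: interpolate with them between approximations of g
    and the constant c. *)
Lemma Baire1_override (R : realType) (T : topologicalType) (k g : T -> R)
    (c : R) : continuous k -> Baire1 g ->
  Baire1 (fun t => if k t == 0 then c else g t).
Proof.
move=> kc [h [hc hg]].
pose b n t := (1 + n%:R * `|k t|)^-1.
have b_gt0 n t : 0 < 1 + n%:R * `|k t|.
  by rewrite (lt_le_trans ltr01)// lerDl mulr_ge0.
exists (fun n t => h n t + b n t * (c - h n t)); split=> [n t|t].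
- apply: cvgD; first exact: hc.
  apply: cvgM; last by apply: cvgB; [exact: cvg_cst|exact: hc].
  apply: cvgV; first by rewrite gt_eqF.
  apply: cvgD; first exact: cvg_cst.
  by apply: cvgM; [exact: cvg_cst|apply: cvg_norm; exact: kc].
- case: ifPn => [/eqP kt|kt].
    rewrite (_ : (fun n => _) = fun=> c); first exact: cvg_cst.
    by apply/funext => n; rewrite /b kt normr0 mulr0 addr0 invr1 mul1r subrKC.
  rewrite -[X in _ --> X]addr0 -[X in _ + X](mul0r (c - g t)).
  apply: cvgD; first exact: hg.
  apply: cvgM; last by apply: cvgB; [exact: cvg_cst|exact: hg].
  apply/gtr0_cvgV0; first by near=> n; exact: b_gt0.
  apply/cvgryPge => A; near=> n.
  rewrite -lerBlDl -ler_pdivrMr ?normr_gt0 //.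
  by near: n; exact: nbhs_infty_ger.
Unshelve. all: by end_near. Qed.

(** The least index rules: a point lying in several zero sets gets the largest of
    the available values, and the value 1 / (j + 1) identifies the index j. *)
Definition layered (R : realType) (T : Type) (k : nat -> T -> R) (p : T) : R :=
  if pselect (exists j, k j p == 0) is left e then (ex_minn e).+1%:R^-1 else 0.

Lemma layeredP (R : realType) (T : Type) (k : nat -> T -> R) (p : T) :
  (exists i, [/\ k i p = 0, forall j, (j < i)%N -> k j p != 0
     & layered k p = i.+1%:R^-1])
  \/ (forall j, k j p != 0) /\ layered k p = 0.
Proof.
rewrite /layered; case: pselect => [e|ne]; [left|right].
- case: ex_minnP => i /eqP ki imin; exists i; split=> // j ji.
  by apply/negP => /imin; rewrite leqNgt ji.
- by split=> // j; apply/negP => kj; apply: ne; exists j.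
Qed.

Lemma layeredE (R : realType) (T : Type) (k : nat -> T -> R) (i : nat) (p : T) :
  k i p = 0 -> (forall j, (j < i)%N -> k j p != 0) ->
  layered k p = i.+1%:R^-1.
Proof.
move=> ki imin; have [[i' [ki' i'min ->]]|[+ _]] := layeredP k p; last first.
  by move=> /(_ i); rewrite ki eqxx.
suff -> : i' = i by [].
apply/eqP; rewrite eqn_leq; apply/andP; split; rewrite leqNgt; apply/negP.
  by move/i'min; rewrite ki eqxx.
by move/imin; rewrite ki' eqxx.
Qed.

(** Keeping only the layers of index less than n changes the value at a given
    point for finitely many n only. *)
Lemma layered_Baire2 (R : realType) (T : topologicalType) (k : nat -> T -> R) :
  (forall j, continuous (k j)) -> Baire2 (layered k).
Proof.
move=> kc.
pose h (s : seq nat) (p : T) : R :=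
  foldr (fun j v => if k j p == 0 then j.+1%:R^-1 else v) 0 s.
have h0 s p : (forall j, j \in s -> k j p != 0) -> h s p = 0.
  elim: s => //= j s IH ks; rewrite (negbTE (ks _ _)) ?mem_head //.
  by apply: IH => i si; rewrite ks // inE si orbT.
exists (fun n => h (iota 0 n)); split=> [n|p].
- elim: (iota 0 n) => [|j s IH]; first exact: Baire1_cst.
  exact: (Baire1_override _ (kc j) IH).
- apply: cvg_near_cst.
  have [[i [ki imin ->]]|[k0 ->]] := layeredP k p; near=> n; last exact: h0.
  have ni : (i < n)%N by near: n; exact: nbhs_infty_gt.
  rewrite -(subnKC ni) addSnnS iotaD add0n /=.
  rewrite /h foldr_cat /= ki eqxx.
  have : all (fun j => k j p != 0) (iota 0 i).
    by apply/allP => j; rewrite mem_iota add0n => /imin.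
  by elim: (iota 0 i) => //= j s IH /andP[/negbTE -> /IH].
Unshelve. all: by end_near. Qed.

(** * Feeble continuity of layered tangent curves *)

Lemma nbhs_sections (R : realType) (x y : R) (V : set (R * R)) :
  nbhs (x, y) V -> (\forall t \near x, V (t, y)) /\ (\forall t \near y, V (x, t)).
Proof.
case=> -[A B] [/= xA yB] AB; split.
- by apply: filterS xA => t At; apply: AB; split => //=; exact: nbhs_singleton yB.
- by apply: filterS yB => t Bt; apply: AB; split => //=; exact: nbhs_singleton xA.
Qed.

Lemma nonzero_near (R : realType) (T : topologicalType) (k : T -> R) (t : T) :
  continuous k -> k t != 0 -> \forall t' \near t, k t' != 0.
Proof.
move=> kc kt; apply: (kc t (fun r => r != 0)).
apply/nbhs_ballP; exists `|k t|; first by rewrite /= normr_gt0.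
move=> r; rewrite /ball /= => h; apply/negP => /eqP r0.
by move: h; rewrite r0 subr0 ltxx.
Qed.

Lemma near_forall_lt (T : Type) (F : set_system T) (n : nat)
    (P : nat -> T -> Prop) : Filter F ->
  (forall j, (j < n)%N -> \forall t \near F, P j t) ->
  \forall t \near F, forall j, (j < n)%N -> P j t.
Proof.
move=> FF FP; have /filterS : \forall t \near F, forall j : 'I_n, P j t.
  by apply: (@filter_forall _ _ (fun (j : 'I_n) t => P j t)) => j; exact: FP.
by apply=> t Pt j jn; exact: (Pt (Ordinal jn)).
Qed.

Definition tan_layers (R : realType) (q s : nat -> R) : R * R -> R :=
  layered (fun j => tan_curve (q j) (s j)).

Lemma tan_layers_Baire2 (R : realType) (q s : nat -> R) :
  Baire2 (tan_layers q s).
Proof. by apply: layered_Baire2 => j; exact: tan_curve_continuous. Qed.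

(** The abscissae are taken where the zero sets of index less than i do not meet
    the line of height q_i, and the ordinates on the i-th curve.  As those
    earlier zero sets are closed, they are eventually avoided on each vertical
    line, so that all the inner limits are 1 / (i + 1). *)
Lemma tan_layers_VFC (R : realType) (q s : nat -> R) (i : nat) (x : R) :
  (forall j, (j < i)%N -> tan_curve (q j) (s j) (x, q i) != 0) ->
  very_feebly_continuous_at (tan_layers q s) (x, q i).
Proof.
move=> kx.
have [u [ux uV]] : exists u, decreases_to u x /\
    forall n j, (j < i)%N -> tan_curve (q j) (s j) (u n, q i) != 0.
  have V : \forall t \near x, forall j, (j < i)%N ->
      tan_curve (q j) (s j) (t, q i) != 0.
    apply: (@near_forall_lt _ (nbhs x)
      i (fun j t => tan_curve (q j) (s j) (t, q i) != 0)) => j ji.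
    by have /nbhs_sections[] := nonzero_near (@tan_curve_continuous _ (q j) (s j))
      (kx j ji).
  exact: decreases_to_in_nbhs V.
have /choice[y yP] n : exists y, decreases_to y (q i) /\
    forall m, tan_curve (q i) (s i) (u n, y m) = 0.
  by have [y yq y0] := tan_curve_zeros (q i) (s i) (u n); exists y.
exists u, y, (fun=> i.+1%:R^-1); split=> //.
- by move=> n; have [] := yP n.
- move=> n; have [yn y0] := yP n; apply: cvg_near_cst.
  have V : \forall t \near q i, forall j, (j < i)%N ->
      tan_curve (q j) (s j) (u n, t) != 0.
    apply: (@near_forall_lt _ (nbhs (q i))
      i (fun j t => tan_curve (q j) (s j) (u n, t) != 0)) => j ji.
    by have /nbhs_sections[] := nonzero_near (@tan_curve_continuous _ (q j) (s j))
      (uV n j ji).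
  have yV : \forall m \near \oo, forall j, (j < i)%N ->
      tan_curve (q j) (s j) (u n, y n m) != 0 by exact: yn.2 _ V.
  by near=> m; apply: layeredE; [exact: y0|near: m].
- rewrite /tan_layers (layeredE (i := i)) //; first exact: cvg_cst.
  exact: tan_curve_line.
Unshelve. all: by end_near. Qed.

(** Pigeonhole: i + 2 abscissae for i + 1 curves, each of which meets a given
    horizontal line at most once. *)
Lemma tan_layers_not_FC (R : realType) (q s : nat -> R) (p : R * R) :
  tan_layers q s p != 0 -> ~ feebly_continuous_at (tan_layers q s) p.
Proof.
rewrite /tan_layers; set k := fun j => _.
have [[i [_ _ pi]] _|[_ ->]] := layeredP k p; last by rewrite eqxx.
move=> [u [v [g [up vp ug]]]]; rewrite pi => gi.
have low z : i.+2%:R^-1 < layered k z -> exists j : 'I_i.+1, k j z = 0.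
  have [[j [kj _ ->]]|[_ ->]] := layeredP k z; last by rewrite ltNge invr_ge0 ler0n.
  rewrite ltf_pV2 ?posrE // ltr_nat ltnS => ji.
  by exists (Ordinal ji).
have [N _ gN] : \forall n \near \oo, i.+2%:R^-1 < g n.
  by apply: (cvgr_gt _ gi); rewrite ltf_pV2 ?posrE // ltr_nat.
have near_zero : \forall m \near \oo, forall n : 'I_i.+2,
    exists j : 'I_i.+1, k j (u (N + n)%N, v m) = 0.
  apply: filter_forall => n.
  have gNn : i.+2%:R^-1 < g (N + n)%N by apply: gN; exact: leq_addr.
  by apply: filterS (cvgr_gt _ (ug _) _ gNn) => m /low.
have off_lines : \forall m \near \oo, forall j : 'I_i.+1, v m != q j.
  by apply: filter_forall => j; exact: decreases_to_neq vp.
have [m [/choice[phi phiP] vq]] := filter_ex (filterI near_zero off_lines).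
(* phi n is the index of a curve through (u (N + n), v m). *)
suff /leq_card : injective phi by rewrite !card_ord ltnn.
move=> n n' nn'; have kn := phiP n; have kn' := phiP n'.
rewrite -nn' in kn'; have uu := tan_curve_inj (vq _) kn kn'.
have := up.1 (N + n)%N (N + n')%N; have := up.1 (N + n')%N (N + n)%N.
rewrite uu lexx !leq_add2l => /esym nn /esym n'n.
by apply/val_inj/eqP; rewrite eqn_leq nn n'n.
Qed.

(** * A single layer *)

Lemma FC_of_locally_constant (R : realType) (f : R * R -> R) (p : R * R) :
  (\forall z \near p, f z = f p) -> feebly_continuous_at f p.
Proof.
case: p => x y [[A B] [/= xA yB] AB].
have [u [ux uA]] := decreases_to_in_nbhs xA.
have [v [vy vB]] := decreases_to_in_nbhs yB.
exists u, v, (fun=> f (x, y)); split=> // [n|]; last exact: cvg_cst.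
apply: cvg_near_cst; near=> m.
exact: (AB (u n, v m) (conj (uA n) (vB m))).
Unshelve. all: by end_near. Qed.

Lemma cst_tan_layersE (R : realType) (q s : R) (p : R * R) :
  tan_layers (fun=> q) (fun=> s) p = if tan_curve q s p == 0 then 1 else 0.
Proof.
rewrite /tan_layers; case: eqP => [k0|/eqP k0].
  by rewrite (layeredE (i := 0)) ?invr1.
by have [[i [/eqP + _ _]]|[_ ->//]] := layeredP (fun=> tan_curve q s) p; rewrite (negbTE k0).
Qed.

(** Off the line, f vanishes near each point outside the curve, so it is feebly
    continuous there.  At a point of the curve f is 1, but on the vertical lines
    to its right f vanishes near the height of the point, so all the inner
    limits are 0. *)
Lemma cst_tan_layers_VFC_diff_FC (R : realType) (q s : R) :
  let f := tan_layers (fun=> q) (fun=> s) in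
  VFC f `\` FC f = [set p | p.2 = q].
Proof.
move=> f; apply/seteqP; split=> -[x y] /=; last first.
  move=> ->; split; first exact: (tan_layers_VFC (i := 0)).
  by apply: tan_layers_not_FC; rewrite cst_tan_layersE tan_curve_line eqxx oner_eq0.
move=> [vfc nfc]; apply/eqP; apply/negPn/negP => yq.
have near0 z : tan_curve q s z != 0 -> \forall z' \near z, f z' = 0.
  move=> /(nonzero_near (@tan_curve_continuous _ _ _)).
  by apply: filterS => z' /negbTE kz'; rewrite /f cst_tan_layersE kz'.
have [k0|/near0 f0] := eqVneq (tan_curve q s (x, y)) 0; last first.
  apply: nfc; apply: FC_of_locally_constant.
  by rewrite [f (x, y)](nbhs_singleton f0).
move: vfc => [u [v [g [ux vy vg]]]].
rewrite /f cst_tan_layersE k0 eqxx => g1.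
suff g0 n : g n = 0.
  have /eqP : 1 = 0 :> R.
    apply: (cvg_unique _ g1) => //; rewrite (_ : g = fun=> 0); last exact/funext.
    exact: cvg_cst.
  by rewrite oner_eq0.
apply: (cvg_unique _ (vg n)) => //; apply: cvg_near_cst.
have /near0/nbhs_sections[_] : tan_curve q s (u n, y) != 0.
  apply/eqP => kn; have := decreases_to_gt n ux.
  by rewrite (tan_curve_inj yq kn k0) ltxx.
exact: (vy n).2.
Qed.

Lemma horizontal_line_perfect (R : realType) (q : R) :
  perfect_set [set p : R * R | p.2 = q].
Proof.
have cl : closed [set p : R * R | p.2 = q].
  apply: (@preimage_closed (R * R)%type R snd [set y | y = q]).
    by move=> p _; exact: cvg_snd.
  exact: closed_eq.
split=> //; apply/seteqP; split.
  by rewrite [X in _ `<=` X](closure_id _).1 //; exact: subset_limit_point.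
move=> [x y] /= -> V [[A B] [/= xA yB] AB].
have [u [ux uA]] := decreases_to_in_nbhs xA.
exists (u 0%N, q); split=> //=.
  apply/eqP => -[ux0]; have := decreases_to_gt 0 ux.
  by rewrite ux0 ltxx.
by apply: AB; split => //=; exact: nbhs_singleton yB.
Qed.

(** * Cardinality of the plane *)

(** Map b to the sum of the b_i / 3^i: at the first index n where two sequences
    differ, the gap 3^-n exceeds the largest possible tail 3^-n / 2. *)
Lemma boolseq_inj_real (R : realType) :
  exists phi : (nat -> bool) -> R, injective phi.
Proof.
pose S (b : nat -> bool) n : R := \sum_(i < n) (b i)%:R * 3^-1 ^+ i.
have SS b n : S b n.+1 = S b n + (b n)%:R * 3^-1 ^+ n.
  by rewrite /S big_ord_recr.
have t0 n : 0 < 3^-1 ^+ n :> R by rewrite exprn_gt0 // invr_gt0.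
have S_le b n m : (n <= m)%N -> S b n <= S b m.
  elim: m => [|m IH]; first by rewrite leqn0 => /eqP ->.
  rewrite leq_eqVlt => /orP[/eqP -> //|]; rewrite ltnS => /IH /le_trans; apply.
  by rewrite SS lerDl mulr_ge0 // ltW.
(* 3 / 2 * 3^-n is the sum of 3^-i over all i >= n. *)
have tail b n m : (n <= m)%N ->
    S b m + 3 / 2 * 3^-1 ^+ m <= S b n + 3 / 2 * 3^-1 ^+ n.
  elim: m => [|m IH]; first by rewrite leqn0 => /eqP ->.
  rewrite leq_eqVlt => /orP[/eqP -> //|]; rewrite ltnS => /IH; apply: le_trans.
  rewrite SS exprS; have := t0 m; case: (b m) => /=; lra.
have upper b n m : S b m <= S b n + 3 / 2 * 3^-1 ^+ n.
  have [nm|/ltnW mn] := leqP n m.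
    by apply: le_trans (tail b n m nm); rewrite lerDl mulr_ge0 // ltW.
  by rewrite (le_trans (S_le b _ _ mn)) // lerDl mulr_ge0 // ltW.
have hub b : has_ubound (range (S b)).
  by exists (S b 0%N + 3 / 2 * 3^-1 ^+ 0) => _ [m _ <-]; exact: upper.
have lub b n : S b n <= sup (range (S b)).
  by apply: ub_le_sup => //; exists n.
have ubs b n : sup (range (S b)) <= S b n + 3 / 2 * 3^-1 ^+ n.
  by apply: ge_sup; [exists (S b 0%N), 0%N|move=> _ [m _ <-]; exact: upper].
exists (fun b => sup (range (S b))) => b b' bb'; apply/funext.
suff main n : (forall i, (i < n)%N -> b i = b' i) -> b n = b' n.
  move=> n; elim/ltn_ind: n => n IH; exact: main.
move=> ih; have Sbb' : S b n = S b' n.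
  by apply: eq_bigr => i _; rewrite ih.
have := lub b n.+1; have := ubs b n.+1; have := lub b' n.+1; have := ubs b' n.+1.
rewrite -bb' !SS Sbb' exprS; have := t0 n.
case: (b n); case: (b' n) => //=; lra.
Qed.

Lemma card_le_inj (T U : Type) (B : set U) (f : T -> U) :
  injective f -> (forall t, B (f t)) -> ([set: T] #<= B)%card.
Proof.
move=> fI fB; rewrite -(card_le_eql (inj_card_eq (f := f) (in2W fI))).
by apply: subset_card_le => _ [t _ <-].
Qed.

(** A pair of reals is coded by its two Dedekind cuts in the rationals, indexed
    by the countable type [bool * rat]. *)
Lemma card_real_pairs (R : realType) : ([set: R * R] #<= [set: R])%card.
Proof.
have [phi phiI] := boolseq_inj_real R.
pose cut (p : R * R) (n : nat) :=
  if @unpickle (bool * rat)%type n is Some (e, r)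
  then ratr r < (if e then p.1 else p.2) else false.
apply: (@card_le_inj _ _ _ (phi \o cut)) => // -[x y] [x' y'] /phiI cc.
have eq_cut (e : bool) :
    (if e then x else y) = (if e then x' else y').
  have c r : (ratr r < (if e then x else y)) = (ratr r < (if e then x' else y')).
    by have := congr1 (fun g => g (pickle (e, r))) cc; rewrite /cut pickleK.
  apply/eqP; rewrite eq_le; apply/andP; split; rewrite leNgt; apply/negP.
    move=> /rat_in_itvoo[r]; rewrite in_itv /= => /andP[h1 h2].
    by move: h2; rewrite c ltNge (ltW h1).
  move=> /rat_in_itvoo[r]; rewrite in_itv /= => /andP[h1 h2].
  by move: h2; rewrite -c ltNge (ltW h1).
by have /= -> := eq_cut true; have /= -> := eq_cut false.
Qed.

(** * Choice of the lines and of the shifts *)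

(** A countable set is Lebesgue-negligible, the real line is not. *)
Lemma real_avoids_countable (R : realType) (v : nat -> R) :
  exists s, forall i, v i != s.
Proof.
have [//|nex] := pselect (exists s, forall i, v i != s).
have : lebesgue_measure (range v) = 0 :> \bar R.
  by apply: countable_lebesgue_measure0; apply: card_image_le.
rewrite (_ : range v = setT); last first.
  apply/seteqP; split=> // s _; apply: contrapT => ns; apply: nex; exists s => i.
  by apply/eqP => vis; apply: ns; exists i.
by rewrite -set_itvNyy lebesgue_measure_itv.
Qed.

(** Each point off the line y = q lies on the curve for at most one shift s. *)
Lemma tan_curve_avoids (R : realType) (q : R) (a : nat -> R * R) :
  exists s, forall i, (a i).2 != q -> tan_curve q s (a i) != 0.
Proof.
have [s sP] := real_avoids_countable (fun i => (a i).1 - tan ((a i).2 - q)^-1).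
exists s => i; case: (a i) (sP i) => x y /= xs yq; apply: contraNN xs => /eqP.
by move/(tan_curve_zero yq) <-; rewrite subKr.
Qed.

Lemma tan_layers_VFC_diff_FC (R : realType) (q s : nat -> R) (i : nat) (x : R) :
  (forall j, (j < i)%N -> tan_curve (q j) (s j) (x, q i) != 0) ->
  (VFC (tan_layers q s) `\` FC (tan_layers q s)) (x, q i).
Proof.
move=> kx; split; first exact: tan_layers_VFC.
apply: tan_layers_not_FC; rewrite /tan_layers (layeredE (i := i)) //.
exact: tan_curve_line.
Qed.

Lemma first_index (T : eqType) (q : nat -> T) (y : T) (n : nat) : q n = y ->
  exists i, q i = y /\ forall j, (j < i)%N -> q j != y.
Proof.
move=> /eqP qn; case: (ex_minnP (ex_intro (fun i => q i == y) n qn)) => i /eqP qi im.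
by exists i; split=> // j ji; apply/negP => /im; rewrite leqNgt ji.
Qed.

(** Point a of A is handled by the first layer whose line contains a; the
    choice of the shifts keeps a off all the earlier zero sets. *)
Lemma countable_subset_VFC_diff_FC (R : realType) (A : set (R * R)) : countable A ->
  exists f : R * R -> R, Baire2 f /\ A `<=` VFC f `\` FC f.
Proof.
move=> /pfcard_geP[->|[a]].
  by exists (tan_layers (fun=> 0) (fun=> 0)); split=> //; exact: tan_layers_Baire2.
have /choice[s sP] j := tan_curve_avoids (a j).2 a.
exists (tan_layers (fun j => (a j).2) s); split; first exact: tan_layers_Baire2.
move=> p /(@surj _ _ _ _ a)[n _ anp].
have [i [qi imin]] := first_index (q := fun j => (a j).2) (erefl (a n).2).
have := @tan_layers_VFC_diff_FC _ (fun j => (a j).2) s i (a n).1.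
rewrite qi -surjective_pairing anp; apply=> j /imin.
by rewrite eq_sym -anp => ?; apply: sP.
Qed.

(** On the first line of height y, the earlier zero sets contain finitely
    many points, so near x0 there is a whole segment of that line inside V; the
    arctangent embeds the reals into it. *)
Lemma VFC_diff_FC_card (R : realType) (q s : nat -> R) (x0 y : R) (n : nat)
    (V : set (R * R)) : q n = y -> nbhs (x0, y) V ->
  ([set: R] #<= (VFC (tan_layers q s) `\` FC (tan_layers q s)) `&` V)%card.
Proof.
move=> /first_index[i [qi imin]] /nbhs_sections[/nbhs_interior x0V _].
have [u [ux uV]] := decreases_to_in_nbhs x0V.
pose k j x := tan_curve (q j) (s j) (x, y).
have : \forall m \near \oo, forall j, (j < i)%N -> k j (u m) != 0.
  apply: near_forall_lt => j ji.
  have := decreases_to_neq (s j + tan (y - q j)^-1) ux; apply: filterS => m.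
  apply: contraNN => /eqP /(tan_curve_zero _) <-; last by rewrite eq_sym imin.
  by rewrite subrKC.
move=> [m _ /(_ m (leqnn m)) km].
have : \forall t \near u m, V (t, y) /\ forall j, (j < i)%N -> k j t != 0.
  apply: filterI; first exact: uV.
  apply: (@near_forall_lt _ (nbhs (u m)) i (fun j t => k j t != 0)) => j ji.
  by have /nbhs_sections[] :=
    nonzero_near (@tan_curve_continuous _ (q j) (s j)) (km j ji).
move=> /nbhs_ballP[e /= e0 eV].
pose f (t : R) := u m + e / pi * atan t.
have fV t : ball (u m) e (f t).
  rewrite /ball /= /f opprD addNKr normrN normrM gtr0_norm; last first.
    by rewrite divr_gt0 ?pi_gt0.
  rewrite mulrAC ltr_pdivrMr ?pi_gt0 // ltr_pM2l // ltr_norml.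
  have := atan_gtNpi2 t; have := atan_ltpi2 t; have := @pi_gt0 R; lra.
apply: (@card_le_inj _ _ _ (fun t => (f t, y))) => [t t' [] |t].
  move=> /addrI/mulfI ee; apply: (can_inj (@atanK R)); apply: ee.
  by rewrite mulf_neq0 ?invr_eq0 ?gt_eqF ?pi_gt0.
have [Vt kt] := eV _ (fV t).
by split=> //; rewrite -qi; apply: tan_layers_VFC_diff_FC => j ji; rewrite qi kt.
Qed.

(** * The theorem *)

Theorem theorem10 (R : realType) :
  [/\ forall A : set (R * R), countable A ->
        exists f : R * R -> R, Baire2 f /\ A `<=` VFC f `\` FC f,
      exists f : R * R -> R,
        [/\ Baire1 f, VFC f `\` FC f !=set0 & perfect_set (VFC f `\` FC f)]
    & exists f : R * R -> R, Baire2 f /\ continuum_dense R (VFC f `\` FC f)].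
Proof.
split.
- exact: countable_subset_VFC_diff_FC.
- exists (tan_layers (fun=> 0) (fun=> 0)); rewrite cst_tan_layers_VFC_diff_FC; split.
  + rewrite (_ : tan_layers _ _ = fun p => if tan_curve 0 0 p == 0 then 1 else 0).
      apply: Baire1_override; first exact: tan_curve_continuous.
      exact: Baire1_cst.
    by apply/funext => p; exact: cst_tan_layersE.
  + by exists (0, 0).
  + exact: horizontal_line_perfect.
- pose q n : R := ratr (odflt 0 (@unpickle rat n)).
  exists (tan_layers q (fun=> 0)); split; first exact: tan_layers_Baire2.
  move=> U oU [[x0 y0] Uxy0].
  have [_ yU] := nbhs_sections (open_nbhs_nbhs (conj oU Uxy0)).
  have [y [oy [r _ ry]]] : (interior [set t | U (x0, t)] `&` range (@ratr R)) !=set0.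
    by apply: dense_rat; [exists y0|exact: open_interior].
  have Uxy : nbhs (x0, y) U.
    by apply: open_nbhs_nbhs; split=> //; exact: nbhs_singleton oy.
  rewrite card_eq_le; apply/andP; split.
    exact: card_le_trans (card_leT _) (card_real_pairs R).
  apply: (VFC_diff_FC_card (n := pickle r) _ _ Uxy).
  by rewrite /q pickleK.
Qed.
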